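(* Let $A,B$, the generalized cosines $c_1,\dots,c_n$, $H$, $S$, $P_S$, $P=\psi_d(S)$ and $\Delta_{\min}$ be as described in the context, for an interval $[c_{\min},c_{\max}]\subset[0,1]$ and series degree $d$. Then $$|\mathrm{tr}(P_S)-\mathrm{tr}(P)|\le\frac{n\pi^6}{2(d+2)^3\Delta_{\min}^4}.$$
   Context: $A\in\mathbb{R}^{m_1\times n}$, $B\in\mathbb{R}^{m_2\times n}$, $m_1+m_2\ge n$, $[A^T,B^T]^T$ of full column rank. GSVD: $U^TAX=\Sigma_A$, $V^TBX=\Sigma_B$ with $X$ nonsingular, $U,V$ orthogonal, $\Sigma_A^T\Sigma_A=\mathrm{diag}(c_1^2,\dots,c_n^2)$, $\Sigma_B^T\Sigma_B=\mathrm{diag}(s_1^2,\dots,s_n^2)$, $c_i,s_i\ge0$, $c_i^2+s_i^2=1$ (values $c_i=0$ and $c_i=1$ correspond to $\mathcal N(A)$ and $\mathcal N(B)$). $H=A^TA+B^TB$, $X^THX=I$, $S=H^{-1}(A^TA-B^TB)=X(2\Sigma_A^T\Sigma_A-I)X^{-1}$. $P_S=X_{in}X_{in}^TH+\frac12X_eX_e^TH$, where $X_{in}$ (resp. $X_e$) consists of the columns $x_i$ of $X$ with $c_i\in(c_{\min},c_{\max})$ (resp. $c_i\in\{c_{\min},c_{\max}\}$). With $l(z)=2z^2-1$, $\alpha=\arccos(l(c_{\min}))$, $\beta=\arccos(l(c_{\max}))$, $\eta_0=(\alpha-\beta)/\pi$, $\eta_j=2(\sin(j\alpha)-\sin(j\beta))/(j\pi)$,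 $\rho_{j,d}=\frac{(d+2-j)\sin\frac{\pi}{d+2}\cos\frac{j\pi}{d+2}+\cos\frac{\pi}{d+2}\sin\frac{j\pi}{d+2}}{(d+2)\sin\frac{\pi}{d+2}}$, let $\psi_d(x)=\sum_{j=0}^d\rho_{j,d}\eta_jT_j(x)$ ($T_j$ Chebyshev polynomials) and $P=\psi_d(S)$. $\Delta_{\min}=\min\{\Delta_{il},\Delta_{ir},\Delta_{ol},\Delta_{or}\}$ with $\Delta_{il}=|\arccos(l(c_{il}))-\alpha|$, $\Delta_{ir}=|\arccos(l(c_{ir}))-\beta|$, $\Delta_{ol}=|\arccos(l(c_{ol}))-\alpha|$, $\Delta_{or}=|\arccos(l(c_{or}))-\beta|$, where $c_{il},c_{ir}$ (resp. $c_{ol},c_{or}$) are the values among $c_1,\dots,c_n$ closest to $c_{\min}$ and $c_{\max}$ inside (resp. outside) $[c_{\min},c_{\max}]$. *)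

(* Defs.v *)
From mathcomp Require Import all_boot all_order all_algebra.
From mathcomp Require Import reals trigo.
Set Implicit Arguments. Unset Strict Implicit. Unset Printing Implicit Defensive.
Import Order.TTheory GRing.Theory Num.Theory.
Local Open Scope ring_scope.

Section GSVDDefs.
Variable R : realType.

Definition lmap (z : R) : R := 2 * z ^+ 2 - 1.

Definition alpha_of (cmin : R) : R := acos (lmap cmin).
Definition beta_of (cmax : R) : R := acos (lmap cmax).

Definition eta_coef (cmin cmax : R) (j : nat) : R :=
  let a := alpha_of cmin in let b := beta_of cmax in
  if j == 0%N then (a - b) / pi
  else 2 * (sin (j%:R * a) - sin (j%:R * b)) / (j%:R * pi).

Definition rho_coef (d j : nat) : R :=
  let N : R := (d + 2)%:R in
  let t := pi / N in
  ((N - j%:R) * sin t * cos (j%:R * t) + cos t * sin (j%:R * t))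
  / (N * sin t).

Fixpoint cheb_pair (n : nat) (S : 'M[R]_n) (j : nat) : 'M[R]_n * 'M[R]_n :=
  match j with
  | 0 => (1%:M, S)
  | j'.+1 => let p := cheb_pair S j' in (p.2, 2 *: (S *m p.2) - p.1)
  end.
Definition cheb_mx (n : nat) (S : 'M[R]_n) (j : nat) : 'M[R]_n :=
  (cheb_pair S j).1.

Definition psi_mx (cmin cmax : R) (d : nat) (n : nat) (S : 'M[R]_n) : 'M[R]_n :=
  \sum_(j < d.+1) (rho_coef d j * eta_coef cmin cmax j) *: cheb_mx S j.

(* P_S = X_in X_in^T H + 1/2 X_e X_e^T H *)
Definition PS_weight (cmin cmax ci : R) : R :=
  if (cmin < ci) && (ci < cmax) then 1
  else if (ci == cmin) || (ci == cmax) then 2^-1 else 0.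

Definition PS_mx (n : nat) (cmin cmax : R) (c : 'I_n -> R)
    (X H : 'M[R]_n) : 'M[R]_n :=
  \sum_(i < n) PS_weight cmin cmax (c i) *: ((col i X *m (col i X)^T) *m H).

Definition seqmin (s : seq R) : option R :=
  if s is x :: s' then Some (foldr Num.min x s') else None.
Definition seqmax (s : seq R) : option R :=
  if s is x :: s' then Some (foldr Num.max x s') else None.

(* c_il, c_ir: values among the c_i closest to cmin, cmax inside [cmin,cmax];
   c_ol: closest to cmin outside (i.e. largest c_i < cmin);
   c_or: closest to cmax outside (i.e. smallest c_i > cmax). *)
Definition c_il n (cmin cmax : R) (c : 'I_n -> R) : option R :=
  seqmin [seq c i | i <- enum 'I_n & (cmin <= c i <= cmax)].
Definition c_ir n (cmin cmax : R) (c : 'I_n -> R) : option R :=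
  seqmax [seq c i | i <- enum 'I_n & (cmin <= c i <= cmax)].
Definition c_ol n (cmin : R) (c : 'I_n -> R) : option R :=
  seqmax [seq c i | i <- enum 'I_n & c i < cmin].
Definition c_or n (cmax : R) (c : 'I_n -> R) : option R :=
  seqmin [seq c i | i <- enum 'I_n & cmax < c i].

(* Delta_min = min of those Delta_{il},Delta_{ir},Delta_{ol},Delta_{or} that exist
   (0 if none exists, which only happens for n = 0). *)
Definition Delta_min n (cmin cmax : R) (c : 'I_n -> R) : R :=
  let a := alpha_of cmin in let b := beta_of cmax in
  let D (o : option R) (t : R) := omap (fun z => `|acos (lmap z) - t|) o in
  odflt 0 (seqmin (pmap id [:: D (c_il cmin cmax c) a; D (c_ir cmin cmax c) b;
                               D (c_ol cmin c) a; D (c_or cmax c) b])).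

End GSVDDefs.

(* Main.v *)
Require Import Defs.
From mathcomp Require Import all_boot all_order all_algebra.
From mathcomp Require Import ring lra.
From mathcomp Require Import boolp functions.
From mathcomp Require Import reals normedtype derive realfun trigo.
Import Order.TTheory GRing.Theory Num.Theory.
Import numFieldNormedType.Exports.
Local Open Scope ring_scope.
Set Implicit Arguments.
Unset Strict Implicit.
Unset Printing Implicit Defensive.

(** Conjugation by [X] diagonalizes both [P_S] and [psi_d(S)], so it is enough
    to bound the error at each angle [theta_i = arccos (2 c_i^2 - 1)]. As a
    function of the angle, [psi_d] is the convolution of the indicator function
    of the arcs [beta < |t| < alpha] with the Jackson kernel [K]. The
    coefficients of [K] are the autocorrelation of a sine window, so [K] is the
    squared modulus of a trigonometric polynomial, hence nonnegative; at an
    angle whose distance to [alpha] and [beta] is at least [Delta], the error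
    is then at most the mass of [K] outside [[-Delta, Delta]]. Markov's
    inequality for the weight [(1 - cos t)^2 >= 4 t^4 / pi^4] bounds this mass
    by a combination of [rho_1] and [rho_2] of order [(d + 2)^(-3)]. *)

Section NewtonIntegral.
Variable R : realType.
Implicit Types (f g F : R -> R) (a b c u v w x : R).

Lemma is_derive_MVT f F a b : a < b -> (forall x, is_derive x 1 F (f x)) ->
  exists2 x, a < x < b & F b - F a = f x * (b - a).
Proof.
move=> ab FP.
have [x] : exists2 x, x \in `]a, b[%R & F b - F a = f x * (b - a).
  apply: MVT => //; apply: derivable_within_continuous => x _.
  exact: (@ex_derive _ _ _ _ _ _ _ (FP x)).
by rewrite in_itv; exists x.
Qed.

Lemma is_derive_bigsum (I : Type) (s : seq I) (F : I -> R -> R) (f : I -> R) x :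
  (forall i, is_derive x 1 (F i) (f i)) ->
  is_derive x 1 (fun t => \sum_(i <- s) F i t) (\sum_(i <- s) f i).
Proof.
move=> FP; rewrite -(fct_sumE s xpredT F).
elim/big_ind2: _ => //; first exact: is_derive_cst.
by move=> *; exact: is_deriveD.
Qed.

Lemma is_derive_mull_id w x : is_derive x 1 (fun t => w * t) w.
Proof.
by apply: is_derive_eq (is_deriveZ w (is_derive_id x 1)) _; exact: mulr1.
Qed.

Lemma is_derive_sin_freq w x :
  is_derive x 1 (fun t => sin (w * t)) (w * cos (w * x)).
Proof.
rewrite mulrC; apply: (@is_derive1_comp _ sin).
exact: is_derive_mull_id.
Qed.

(* The integrals needed below are those of trigonometric polynomials, whose
   primitives are explicit; no theory of integration is required for them. *)
Definition newton_integral f a b v :=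
  exists2 F : R -> R, forall x, is_derive x 1 F (f x) & F b - F a = v.

Lemma newton_integral_ext f g a b v : f =1 g ->
  newton_integral f a b v -> newton_integral g a b v.
Proof. by move=> /funext ->. Qed.

Lemma newton_integral_cst c a b : newton_integral (fun=> c) a b (c * (b - a)).
Proof.
exists (fun t => c * t); last by rewrite mulrBr.
by move=> x; exact: is_derive_mull_id.
Qed.

Lemma newton_integralD f g a b u v :
  newton_integral f a b u -> newton_integral g a b v ->
  newton_integral (fun t => f t + g t) a b (u + v).
Proof.
move=> [F dF <-] [G dG <-]; exists (fun t => F t + G t); last by ring.
by move=> x; exact: is_deriveD.
Qed.

Lemma newton_integralZ f a b c v : newton_integral f a b v ->
  newton_integral (fun t => c * f t) a b (c * v).
Proof.
move=> [F dF <-]; exists (fun t => c * F t); last by rewrite mulrBr.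
by move=> x; exact: is_deriveZ.
Qed.

Lemma newton_integral_sum (I : Type) (s : seq I) (f : I -> R -> R) a b
    (v : I -> R) :
  (forall i, newton_integral (f i) a b (v i)) ->
  newton_integral (fun t => \sum_(i <- s) f i t) a b (\sum_(i <- s) v i).
Proof.
move=> fv; rewrite -(fct_sumE s xpredT f).
elim/big_ind2: _ => // [|g u h w]; last exact: newton_integralD.
by have := newton_integral_cst 0 a b; rewrite mul0r.
Qed.

Lemma newton_integral_split f a b c v : newton_integral f a b v ->
  exists u w, [/\ newton_integral f a c u, newton_integral f c b w & v = u + w].
Proof.
move=> [F dF <-]; exists (F c - F a), (F b - F c).
by split; [exists F | exists F | ring].
Qed.

Lemma newton_integral_ge0 f a b v :
  a <= b -> (forall x, a < x < b -> 0 <= f x) ->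
  newton_integral f a b v -> 0 <= v.
Proof.
rewrite le_eqVlt => /predU1P[-> _ [F _ <-]|ab f_ge0 [F dF <-]].
  by rewrite subrr.
have [x xab ->] := is_derive_MVT ab dF.
by rewrite mulr_ge0 ?f_ge0// subr_ge0 ltW.
Qed.

Lemma newton_integral_markov f g a b c u v : a <= c -> c <= b ->
  (forall x, 0 <= f x) -> (forall x, 0 <= g x) ->
  (forall x, c < x < b -> g c <= g x) ->
  newton_integral f c b u -> newton_integral (fun x => g x * f x) a b v ->
  g c * u <= v.
Proof.
move=> ac cb f_ge0 g_ge0 gc_le fu.
move=> /(newton_integral_split c)[v1 [v2 [gfv1 gfv2 ->]]].
have v1_ge0 : 0 <= v1.
  by apply: newton_integral_ge0 ac _ gfv1 => x _; rewrite mulr_ge0.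
suff : 0 <= v2 + - g c * u by lra.
have gcfu := newton_integralZ (- g c) fu.
apply: newton_integral_ge0 cb _ (newton_integralD gfv2 gcfu) => x xcb.
by rewrite mulNr -mulrBl mulr_ge0// subr_ge0 gc_le.
Qed.

Lemma newton_integral_cos_freq w a b : w != 0 ->
  newton_integral (fun t => cos (w * t)) a b ((sin (w * b) - sin (w * a)) / w).
Proof.
move=> w0; exists (fun t => w^-1 * sin (w * t)); last by rewrite -mulrBr mulrC.
move=> x; apply: is_derive_eq (is_deriveZ w^-1 (is_derive_sin_freq w x)) _.
exact: mulKf.
Qed.

End NewtonIntegral.

Section Trigonometry.
Variable R : realType.
Implicit Types (N t x : R) (j k m : nat).

Lemma norm_sin_le x : `|sin x| <= `|x|.
Proof.
wlog x_gt0 : x / 0 < x => [wl|].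
  have [/wl//|x_lt0|<-] := ltgtP 0 x; last by rewrite sin0 normr0.
  by have := wl (- x); rewrite sinN !normrN oppr_gt0; apply.
have [y _] := is_derive_MVT x_gt0 (@is_derive_sin R).
rewrite sin0 !subr0 => ->; rewrite normrM.
by rewrite ler_piMl// cos_max.
Qed.

Lemma sqr_sin_le x : sin x ^+ 2 <= x ^+ 2.
Proof.
rewrite -(real_normK (num_real (sin x))) -(real_normK (num_real x)).
by rewrite lerXn2r ?nnegrE ?norm_sin_le.
Qed.

Lemma Jordan_sin x : 0 <= x <= pi / 2 -> 2 * x / pi <= sin x.
Proof.
move=> /andP[x_ge0 x_le]; have pi_pos := @pi_gt0 R.
have [->|x_neq0] := eqVneq x 0; first by rewrite mulr0 mul0r sin0.
have [->|x_neq_pihalf] := eqVneq x (pi / 2).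
  by rewrite sin_pihalf mulrCA divff ?pnatr_eq0// mulr1 divff// lt0r_neq0.
have x_gt0 : 0 < x by rewrite lt_neqAle eq_sym x_neq0.
have x_lt : x < pi / 2 by rewrite lt_neqAle x_neq_pihalf.
rewrite leNgt; apply/negP => sin_lt.
have [u /andP[u_gt0 u_lt]] := is_derive_MVT x_gt0 (@is_derive_sin R).
have [v /andP[v_gt v_lt]] := is_derive_MVT x_lt (@is_derive_sin R).
rewrite sin0 sin_pihalf !subr0 => sin_right sin_left.
have cos_vu : cos v < cos u by rewrite ltr_cos ?in_itv/=; lra.
have : cos u < 2 / pi by rewrite -(ltr_pM2r x_gt0) -sin_left mulrAC.
suff : 2 / pi < cos v by lra.
rewrite -(@ltr_pM2r _ (pi / 2 - x)) ?subr_gt0// -sin_right.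
have -> : 2 / pi * (pi / 2 - x) = 1 - 2 * x / pi.
  by move: (pi : R) (lt0r_neq0 pi_pos) => p p0; field.
by rewrite ltrD2l ltrN2.
Qed.

Lemma one_sub_cosE x : 1 - cos x = 2 * sin (x / 2) ^+ 2.
Proof.
have {1}-> : x = (x / 2) *+ 2 by rewrite -mulr_natr divfK ?pnatr_eq0.
by rewrite cos_mulr2n sin2cos2; ring.
Qed.

Lemma one_sub_cos_ge x : 0 <= x <= pi -> 2 * x ^+ 2 / pi ^+ 2 <= 1 - cos x.
Proof.
move=> /andP[x_ge0 x_le]; have pi_pos := @pi_gt0 R.
have : 2 * (x / 2) / pi <= sin (x / 2) by apply: Jordan_sin; lra.
rewrite mulrCA divff ?pnatr_eq0// mulr1 => sin_ge.
have xpi_ge0 : 0 <= x / pi by rewrite divr_ge0// ltW.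
rewrite one_sub_cosE -mulrA ler_pM2l// -expr_div_n.
by rewrite lerXn2r ?nnegrE// (le_trans xpi_ge0).
Qed.

(* With [s := sin (pi / (2 N)) ^+ 2] the left-hand side is
   [4 s (1 + (N - 1) s) / N], and [(N - 1) s <= 1] because [pi <= 4]. *)
Lemma cos_pi_div_moment_le N (c := cos (pi / N)) : 2 <= N ->
  (1 - c) ^+ 2 + (1 - c ^+ 2) / N <= 2 * pi ^+ 2 / N ^+ 3.
Proof.
rewrite /c => N_ge2; have pi_pos := @pi_gt0 R.
have pi_le4 : pi <= 4 :> R by have := pihalf_lt2 R; lra.
have N_neq0 : N != 0 by rewrite lt0r_neq0//; lra.
pose u := pi / N / 2; pose s := sin u ^+ 2.
have cE : cos (pi / N) = 1 - 2 * s.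
  by have := one_sub_cosE (pi / N); rewrite -/u -/s; lra.
have uE : N * u = pi / 2 by rewrite /u; field.
have s_le : s <= u ^+ 2 by exact: sqr_sin_le.
have s_ge0 : 0 <= s by exact: sqr_ge0.
have Ns_le1 : (N - 1) * s <= 1.
  have N2s_le : N ^+ 2 * s <= N ^+ 2 * u ^+ 2 by rewrite ler_wpM2l ?sqr_ge0.
  have N2u2_le : N ^+ 2 * u ^+ 2 <= 4 by rewrite -exprMn uE; nra.
  have : 0 <= (N - 2) ^+ 2 * s by rewrite mulr_ge0 ?sqr_ge0.
  lra.
have -> : (1 - cos (pi / N)) ^+ 2 + (1 - cos (pi / N) ^+ 2) / N
    = 4 * (s * (1 + (N - 1) * s)) / N by rewrite cE; field.
have -> : 2 * pi ^+ 2 / N ^+ 3 = 4 * (u ^+ 2 * 2) / N.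
  by rewrite /u; field.
rewrite ler_pM2r ?invr_gt0; last by lra.
rewrite ler_pM2l// ler_pM//; last lra.
by rewrite addr_ge0// mulr_ge0//; lra.
Qed.

Lemma sin_natpi k : sin (k%:R * pi) = 0 :> R.
Proof.
elim: k => [|k IHk]; first by rewrite mul0r sin0.
by rewrite -natr1 mulrDl mul1r sinDpi IHk oppr0.
Qed.

Lemma sin_nat_2piB k x : sin (k%:R * (2 * pi - x)) = - sin (k%:R * x).
Proof.
have -> : k%:R * (2 * pi - x) = - (k%:R * x) + (pi *+ 2) *+ k by ring.
by rewrite periodicn ?sinN//; exact: sinD2pi.
Qed.

Lemma sum_sin_mul_sin t j m :
  4 * sin t * \sum_(0 <= k < m) sin (k.+1%:R * t) * sin ((k + j).+1%:R * t)
  = 2 * m%:R * sin t * cos (j%:R * t)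
    - sin ((2 * m + j).+1%:R * t) + sin (j.+1%:R * t).
Proof.
elim: m => [|m IHm]; first by rewrite big_geq// muln0 !add0n; ring.
rewrite big_nat_recr//= mulrDr IHm.
have -> : (2 * m.+1 + j).+1%:R * t = m.+1%:R * t + (m + j).+1%:R * t + t.
  by ring.
have -> : (2 * m + j).+1%:R * t = m.+1%:R * t + (m + j).+1%:R * t - t by ring.
have -> : j%:R * t = (m + j).+1%:R * t - m.+1%:R * t by ring.
rewrite cosB [in RHS]sinD sinB sinD cosD; ring.
Qed.

Lemma sin_pi_div_gt0 m : (1 < m)%N -> 0 < sin (pi / m%:R : R).
Proof.
move=> m_gt1; have pi_pos := @pi_gt0 R; have m_gt0 := ltnW m_gt1.
by rewrite sin_gt0_pi// divr_gt0 ?ltr0n//= ltr_pdivrMr ?ltr0n// ltr_pMr// ltr1n.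
Qed.

Lemma newton_integral_cos_nat k :
  newton_integral (fun t => cos (k%:R * t)) 0 pi (pi * (k == 0)%:R : R).
Proof.
case: k => [|k].
  have := newton_integral_cst 1 0 (pi : R); rewrite subr0 mulrC.
  by apply: newton_integral_ext => t; rewrite mul0r cos0.
have k0 : k.+1%:R != 0 :> R by rewrite pnatr_eq0.
have := newton_integral_cos_freq 0 pi k0.
by rewrite sin_natpi mulr0 sin0 subr0 mul0r mulr0.
Qed.

Lemma newton_integral_cos_nat_mul k m :
  newton_integral (fun t => cos (k%:R * t) * cos (m%:R * t)) 0 pi
    (pi / 2 * ((k == m)%:R + (k + m == 0)%N%:R) : R).
Proof.
wlog mk : k m / (m <= k)%N => [wl|].
  have [/wl//|/ltnW/wl] := leqP m k.
  rewrite eq_sym addnC; apply: newton_integral_ext => t; exact: mulrC.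
have := newton_integralZ 2^-1
  (newton_integralD (newton_integral_cos_nat (k - m))
                    (newton_integral_cos_nat (k + m))).
rewrite subn_eq0 -[(k <= m)%N]andbT -mk -eqn_leq -mulrDr mulrA [2^-1 * _]mulrC.
apply: newton_integral_ext => t.
by rewrite natrB// natrD mulrBl mulrDl cosB cosD; field.
Qed.

Lemma le_acos : {in `[-1, 1] &, {mono @acos R : x y /~ x <= y}}.
Proof.
move=> x y xI yI; rewrite !leNgt -ltr_cos ?acosK//.
  by rewrite in_itv/= acos_ge0 ?acos_lepi//; move: xI; rewrite in_itv.
by rewrite in_itv/= acos_ge0 ?acos_lepi//; move: yI; rewrite in_itv.
Qed.

End Trigonometry.

Section CosineKernel.
Variables (R : realType) (r : nat -> R) (d : nat).
Implicit Types (a b t u x D : R) (j k m : nat).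

Definition cos_kernel t : R :=
  r 0%N + 2 * \sum_(1 <= j < d.+1) r j * cos (j%:R * t).

Definition cos_kernel_primitive t : R :=
  r 0%N * t + 2 * \sum_(1 <= j < d.+1) r j / j%:R * sin (j%:R * t).

Lemma is_derive_cos_kernel_primitive x :
  is_derive x 1 cos_kernel_primitive (cos_kernel x).
Proof.
apply: is_deriveD (is_derive_mull_id _ _) _; apply: is_deriveZ.
have dsum := is_derive_bigsum (index_iota 1 d.+1) (fun j =>
  is_deriveZ (r j / j%:R) (is_derive_sin_freq j%:R x)).
apply: is_derive_eq dsum _.
apply: eq_big_nat => j /andP[j_gt0 _]; rewrite /GRing.scale/= mulrA divfK//.
by rewrite pnatr_eq0 -lt0n.
Qed.

Lemma cos_kernel_primitiveN t :
  cos_kernel_primitive (- t) = - cos_kernel_primitive t.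
Proof.
rewrite /cos_kernel_primitive opprD -!mulrN -sumrN; congr (_ + 2 * _).
by apply: eq_bigr => j _; rewrite mulrN sinN mulrN.
Qed.

Lemma cos_kernel_primitive_2piB t :
  cos_kernel_primitive (2 * pi - t) = 2 * pi * r 0%N - cos_kernel_primitive t.
Proof.
rewrite /cos_kernel_primitive mulrBr [r 0%N * (2 * pi)]mulrC opprD addrA.
congr (_ + _); rewrite -mulrN -sumrN; congr (2 * _).
by apply: eq_bigr => j _; rewrite sin_nat_2piB mulrN.
Qed.

Lemma newton_integral_cos_kernel a b :
  newton_integral cos_kernel a b
    (cos_kernel_primitive b - cos_kernel_primitive a).
Proof.
by exists cos_kernel_primitive => // x; exact: is_derive_cos_kernel_primitive.
Qed.

Lemma newton_integral_cos_kernel_cos m :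
  newton_integral (fun t => cos_kernel t * cos (m%:R * t)) 0 pi
    (if (m <= d)%N then pi * r m else 0).
Proof.
have := newton_integralD
  (newton_integralZ (r 0%N) (newton_integral_cos_nat R m))
  (newton_integralZ 2 (newton_integral_sum (index_iota 1 d.+1) (fun j =>
    newton_integralZ (r j) (newton_integral_cos_nat_mul R j m)))).
set v := (X in newton_integral _ _ _ X).
have -> : v = if (m <= d)%N then pi * r m else 0.
  pose term j := if j == m then pi * r j else 0.
  rewrite /v mulr_sumr (eq_big_nat _ _ (F2 := term)).
    rewrite -big_mkcond big_nat1_eq; case: m {v term} => [|m] /=.
      by rewrite mulr1; ring.
    by rewrite !mulr0 add0r.
  move=> j /andP[j_gt0 _]; rewrite /term addn_eq0 [j == 0]gtn_eqF// addr0.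
  by case: eqP => _; rewrite /= ?mulr0//; field.
apply: newton_integral_ext => t.
rewrite /cos_kernel [RHS]mulrDl -[in RHS]mulrA mulr_suml; congr (_ + 2 * _).
by apply: eq_bigr => j _; rewrite mulrA.
Qed.

Definition arc_fourier_coef a b j : R :=
  if j == 0%N then (a - b) / pi
  else 2 * (sin (j%:R * a) - sin (j%:R * b)) / (j%:R * pi).

Definition smoothed_arc a b t : R :=
  \sum_(j < d.+1) r j * arc_fourier_coef a b j * cos (j%:R * t).

(* [smoothed_arc a b] is the convolution of [cos_kernel] with the indicator
   function of the arcs [b < |t| < a]. *)
Lemma smoothed_arcE a b t : 2 * pi * smoothed_arc a b t =
  cos_kernel_primitive (a + t) + cos_kernel_primitive (a - t)
  - cos_kernel_primitive (b + t) - cos_kernel_primitive (b - t).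
Proof.
have pi_neq0 := lt0r_neq0 (@pi_gt0 R).
pose term j := r j * arc_fourier_coef a b j * cos (j%:R * t).
rewrite /smoothed_arc -(big_mkord xpredT term) {}/term.
rewrite big_ltn// /cos_kernel_primitive {1}/arc_fourier_coef/= mul0r cos0 mulr1.
set sum_coef := \sum_(1 <= j < _) _; set sum_aD := \sum_(1 <= j < _) _.
set sum_aB := \sum_(1 <= j < _) _; set sum_bD := \sum_(1 <= j < _) _.
set sum_bB := \sum_(1 <= j < _) _.
have sum_coefE : pi * sum_coef = sum_aD + sum_aB - sum_bD - sum_bB.
  rewrite /sum_coef /sum_aD /sum_aB /sum_bD /sum_bB.
  rewrite -big_split/= -!sumrB mulr_sumr.
  apply: eq_big_nat => j /andP[j_gt0 _]; rewrite /arc_fourier_coef gtn_eqF//.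
  have : j%:R != 0 :> R by rewrite pnatr_eq0 -lt0n.
  move: (pi : R) pi_neq0 (j%:R : R) => p p0 J J0.
  rewrite ![J * (_ + _)]mulrDr !mulrN !sinD !sinN !cosN; field.
  by rewrite p0 J0.
have -> : 2 * pi * (r 0%N * ((a - b) / pi) + sum_coef)
    = 2 * r 0%N * (a - b) + 2 * (pi * sum_coef).
  by move: (pi : R) pi_neq0 => p p0; field.
by rewrite sum_coefE; ring.
Qed.

Hypothesis cos_kernel_ge0 : forall t, 0 <= cos_kernel t.

Lemma cos_kernel_primitive_le t u :
  t <= u -> cos_kernel_primitive t <= cos_kernel_primitive u.
Proof.
move=> tu; rewrite -subr_ge0.
exact: newton_integral_ge0 tu _ (newton_integral_cos_kernel t u).
Qed.

Hypothesis r0_eq1 : r 0%N = 1.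

Let G := cos_kernel_primitive.
Let G_le := cos_kernel_primitive_le.

Let GN u x : G (u - x) = - G (x - u).
Proof. by rewrite -opprB /G cos_kernel_primitiveN. Qed.

Let G_2piB u : G u = 2 * pi - G (2 * pi - u).
Proof. by rewrite /G cos_kernel_primitive_2piB r0_eq1; ring. Qed.

Lemma smoothed_arc_ge0 a b t : b <= a -> 0 <= smoothed_arc a b t.
Proof.
move=> b_le_a; have pi_pos := @pi_gt0 R.
rewrite -(@pmulr_rge0 _ (2 * pi)) ?mulr_gt0// smoothed_arcE.
have : G (b + t) <= G (a + t) by apply: G_le; lra.
have : G (b - t) <= G (a - t) by apply: G_le; lra.
rewrite /G; lra.
Qed.

Lemma smoothed_arc_le1 a b t : 0 <= b -> a <= pi -> smoothed_arc a b t <= 1.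
Proof.
move=> b_ge0 a_le_pi; have pi_pos := @pi_gt0 R.
rewrite -(@ler_pM2l _ (2 * pi)) ?mulr_gt0// smoothed_arcE mulr1.
rewrite -/G [G (a + t)]G_2piB [G (b - t)]GN.
have : G (a - t) <= G (2 * pi - (a + t)) by apply: G_le; lra.
have : G (t - b) <= G (b + t) by apply: G_le; lra.
lra.
Qed.

Lemma smoothed_arc_ge_inside a b t D : b <= a -> D <= a - t -> D <= t - b ->
  cos_kernel_primitive D <= pi * smoothed_arc a b t.
Proof.
move=> b_le_a Da Db; have := smoothed_arcE a b t; rewrite -/G [G (b - t)]GN.
have : G (b + t) <= G (a + t) by apply: G_le; lra.
have := G_le Da; have := G_le Db; rewrite -/G; lra.
Qed.

Lemma smoothed_arc_le_outside a b t D :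
  0 <= b -> a <= pi -> 0 <= t <= pi -> D <= t - a \/ D <= b - t ->
  pi * smoothed_arc a b t <= pi - cos_kernel_primitive D.
Proof.
move=> b_ge0 a_le_pi /andP[t_ge0 t_le] D_le.
have := smoothed_arcE a b t; rewrite -/G.
case: D_le => [Da|Db].
  rewrite [G (a + t)]G_2piB [G (a - t)]GN [G (b - t)]GN.
  have : G D <= G (2 * pi - (a + t)) by apply: G_le; lra.
  have : G (t - b) <= G (b + t) by apply: G_le; lra.
  have := G_le Da; rewrite -/G; lra.
rewrite [G (a + t)]G_2piB.
have : G (a - t) <= G (2 * pi - (a + t)) by apply: G_le; lra.
have : G D <= G (b + t) by apply: G_le; lra.
have := G_le Db; rewrite -/G; lra.
Qed.

End CosineKernel.

Section Autocorrelation.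
Variable K : pzSemiRingType.
Implicit Types (w : nat -> K) (j m : nat).

Definition autocorr w m j : K := \sum_(0 <= k < m - j) w k * w (k + j)%N.

Lemma autocorr_ge w m j : (m <= j)%N -> autocorr w m j = 0.
Proof. by move=> mj; rewrite /autocorr big_geq// leqn0 subn_eq0. Qed.

Lemma autocorrS w m j : (j <= m)%N ->
  autocorr w m.+1 j = autocorr w m j + w (m - j)%N * w m.
Proof. by move=> jm; rewrite /autocorr subSn// big_nat_recr//= subnK. Qed.

End Autocorrelation.

Section AutocorrelationKernel.
Variable R : realType.
Implicit Types (w : nat -> R) (t : R) (d : nat).

Lemma cos_kernel_autocorrS w d t :
  cos_kernel (autocorr w d.+2) d.+1 t = cos_kernel (autocorr w d.+1) d t
    + w d.+1 ^+ 2
    + 2 * w d.+1 * \sum_(0 <= k < d.+1) w k * cos ((d.+1 - k)%:R * t).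
Proof.
have -> : \sum_(0 <= k < d.+1) w k * cos ((d.+1 - k)%:R * t)
    = \sum_(1 <= j < d.+2) w (d.+1 - j)%N * cos (j%:R * t).
  rewrite big_add1 [RHS]big_nat_rev; apply: eq_big_nat => j /andP[_ jd].
  by rewrite add0n subnSK// subKn 1?ltnW.
rewrite /cos_kernel autocorrS// subn0.
under eq_big_nat => j /andP[_ jd] do rewrite autocorrS// mulrDl.
rewrite big_split/= [X in 2 * (X + _)]big_nat_recr//=.
rewrite (autocorr_ge _ (leqnn _)) mul0r addr0.
have -> : \sum_(1 <= j < d.+2) w (d.+1 - j)%N * w d.+1 * cos (j%:R * t)
    = w d.+1 * \sum_(1 <= j < d.+2) w (d.+1 - j)%N * cos (j%:R * t).
  by rewrite mulr_sumr; apply: eq_bigr => j _; ring.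
ring.
Qed.

Lemma cos_kernel_autocorrE w d t :
  cos_kernel (autocorr w d.+1) d t =
    (\sum_(0 <= k < d.+1) w k * cos (k%:R * t)) ^+ 2
    + (\sum_(0 <= k < d.+1) w k * sin (k%:R * t)) ^+ 2.
Proof.
elim: d => [|d IHd].
  rewrite /cos_kernel big_geq// /autocorr subn0 !big_nat1 mul0r cos0 sin0.
  by rewrite addn0; ring.
rewrite cos_kernel_autocorrS.
have -> : \sum_(0 <= k < d.+1) w k * cos ((d.+1 - k)%:R * t)
    = cos (d.+1%:R * t) * \sum_(0 <= k < d.+1) w k * cos (k%:R * t)
      + sin (d.+1%:R * t) * \sum_(0 <= k < d.+1) w k * sin (k%:R * t).
  rewrite !mulr_sumr -big_split/=; apply: eq_big_nat => k /andP[_ kd].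
  by rewrite natrB 1?ltnW// mulrBl cosB; ring.
rewrite {}IHd !(@big_nat_recr _ _ _ d.+1)//=.
have -> : w d.+1 ^+ 2
    = w d.+1 ^+ 2 * (cos (d.+1%:R * t) ^+ 2 + sin (d.+1%:R * t) ^+ 2).
  by rewrite cos2Dsin2 mulr1.
ring.
Qed.

Lemma cos_kernel_autocorr_ge0 w d t : 0 <= cos_kernel (autocorr w d.+1) d t.
Proof. by rewrite cos_kernel_autocorrE addr_ge0// sqr_ge0. Qed.

End AutocorrelationKernel.

Section JacksonKernel.
Variable R : realType.
Implicit Types (t x D : R) (d j k m : nat).

Definition sine_window d k : R := sin (k.+1%:R * (pi / (d + 2)%:R)).

Lemma rho_coef_autocorr d j : (j <= d.+1)%N ->
  rho_coef R d j = 2 / (d + 2)%:R * autocorr (sine_window d) d.+1 j.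
Proof.
move=> jd; have N_neq0 : (d + 2)%:R != 0 :> R by rewrite pnatr_eq0 addn2.
have := sin_pi_div_gt0 R (isT : 1 < d.+2)%N; rewrite -addn2 => /lt0r_neq0.
have := sum_sin_mul_sin (pi / (d + 2)%:R : R) j (d.+1 - j).
rewrite /rho_coef /autocorr /sine_window; set T := \sum_(0 <= k < _) _.
set t := pi / (d + 2)%:R.
have -> : (2 * (d.+1 - j) + j).+1%:R * t = pi *+ 2 - j.+1%:R * t.
  have <- : (d + 2)%:R * t = pi by rewrite mulrC divfK.
  by rewrite -natr1 natrD natrM (natrB _ jd); ring.
have -> : j.+1%:R * t = j%:R * t + t by ring.
rewrite sinB sin2pi cos2pi natrB// sinD => TE sin_neq0.
have -> : T = 4 * sin t * T / (4 * sin t) by field.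
rewrite {}TE; field.
by rewrite sin_neq0 -natrD N_neq0.
Qed.

Lemma rho_coef_eq0 d j : (d < j <= d + 2)%N -> rho_coef R d j = 0.
Proof.
case/andP=> dj; rewrite leq_eqVlt addn2 ltnS => /predU1P[->|jd]; last first.
  by rewrite rho_coef_autocorr// autocorr_ge// mulr0.
rewrite /rho_coef addn2 subrr !mul0r add0r [_%:R * _]mulrC divfK ?pnatr_eq0//.
by rewrite sinpi mulr0 mul0r.
Qed.

Lemma rho_coef0 d : rho_coef R d 0 = 1.
Proof.
rewrite /rho_coef mul0r cos0 sin0 subr0 mulr1 mulr0 addr0 divff// addn2.
by rewrite mulf_neq0 ?pnatr_eq0// lt0r_neq0// sin_pi_div_gt0.
Qed.

Lemma rho_coef1 d : rho_coef R d 1 = cos (pi / (d + 2)%:R).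
Proof.
rewrite /rho_coef mul1r addn2; have := lt0r_neq0 (@sin_pi_div_gt0 R d.+2 isT).
have : d.+2%:R != 0 :> R by rewrite pnatr_eq0.
move: d.+2%:R (cos _) (sin _) => N c s N0 s0; field.
by rewrite s0.
Qed.

Lemma rho_coef2 d (c := cos (pi / (d + 2)%:R) : R) :
  rho_coef R d 2 = 2 * c ^+ 2 - 1 + 2 / (d + 2)%:R * (1 - c ^+ 2).
Proof.
rewrite /rho_coef /c addn2 mulr_natl cos_mulr2n sin_mulr2n.
have := lt0r_neq0 (@sin_pi_div_gt0 R d.+2 isT).
have : d.+2%:R != 0 :> R by rewrite pnatr_eq0.
move: d.+2%:R (cos _) (sin _) => N {}c s N0 s0; field.
by rewrite N0.
Qed.

Definition jackson_kernel d : R -> R := cos_kernel (rho_coef R d) d.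

Definition jackson_primitive d : R -> R :=
  cos_kernel_primitive (rho_coef R d) d.

Lemma jackson_kernel_ge0 d t : 0 <= jackson_kernel d t.
Proof.
suff -> : jackson_kernel d t
    = 2 / (d + 2)%:R * cos_kernel (autocorr (sine_window d) d.+1) d t.
  by rewrite mulr_ge0 ?divr_ge0 ?cos_kernel_autocorr_ge0.
rewrite /jackson_kernel /cos_kernel rho_coef_autocorr// mulrDr mulrCA.
congr (_ + 2 * _); rewrite mulr_sumr; apply: eq_big_nat => j /andP[_ jd].
by rewrite mulrA rho_coef_autocorr// ltnW.
Qed.

Lemma newton_integral_jackson_cos d m : (m <= d + 2)%N ->
  newton_integral (fun t => jackson_kernel d t * cos (m%:R * t)) 0 pi
    (pi * rho_coef R d m).
Proof.
move=> md; have := newton_integral_cos_kernel_cos (rho_coef R d) d m.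
by case: leqP => // dm; rewrite rho_coef_eq0 ?dm// mulr0.
Qed.

Lemma newton_integral_jackson_sqr_one_sub_cos d
    (c := cos (pi / (d + 2)%:R) : R) :
  newton_integral (fun t => (1 - cos t) ^+ 2 * jackson_kernel d t) 0 pi
    (pi * ((1 - c) ^+ 2 + (1 - c ^+ 2) / (d + 2)%:R)).
Proof.
have int m (m_le2 : (m <= 2)%N) :=
  newton_integral_jackson_cos (leq_trans m_le2 (leq_addl d 2)).
have := newton_integralD (newton_integralZ (3 / 2) (int 0%N isT))
  (newton_integralD (newton_integralZ (- 2) (int 1%N isT))
                    (newton_integralZ 2^-1 (int 2%N isT))).
set v := (X in newton_integral _ _ _ X).
have -> : v = pi * ((1 - c) ^+ 2 + (1 - c ^+ 2) / (d + 2)%:R).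
  rewrite /v rho_coef0 rho_coef1 rho_coef2 -/c.
  have : (d + 2)%:R != 0 :> R by rewrite pnatr_eq0 addn2.
  by move: (_ + 2)%:R => N N0; field.
apply: newton_integral_ext => t.
by rewrite mul0r cos0 mul1r [2 * t]mulr_natl cos_mulr2n; field.
Qed.

Lemma jackson_primitive_le d t u :
  t <= u -> jackson_primitive d t <= jackson_primitive d u.
Proof. exact: (cos_kernel_primitive_le (@jackson_kernel_ge0 d)). Qed.

Lemma jackson_primitive_pi d : jackson_primitive d pi = pi.
Proof.
have := cos_kernel_primitive_2piB (rho_coef R d) d pi.
have -> : 2 * pi - pi = pi :> R by ring.
rewrite rho_coef0 /jackson_primitive; lra.
Qed.

Lemma jackson_tail_markov d D : 0 <= D <= pi ->
  (1 - cos D) ^+ 2 * (pi - jackson_primitive d D)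
    <= 2 * pi ^+ 3 / (d + 2)%:R ^+ 3.
Proof.
move=> /andP[D_ge0 D_le_pi].
have weight_le x : D < x < pi -> (1 - cos D) ^+ 2 <= (1 - cos x) ^+ 2.
  move=> /andP[Dx xpi]; rewrite lerXn2r ?nnegrE ?subr_ge0 ?cos_le1// lerB//.
  by rewrite ltW// ltr_cos ?in_itv/=; lra.
have tail := newton_integral_cos_kernel (rho_coef R d) d D pi.
have := newton_integral_markov D_ge0 D_le_pi (@jackson_kernel_ge0 d)
  (fun x => sqr_ge0 (1 - cos x)) weight_le tail
  (newton_integral_jackson_sqr_one_sub_cos d).
rewrite -/(jackson_primitive d) jackson_primitive_pi => /le_trans; apply.
have -> : 2 * pi ^+ 3 / (d + 2)%:R ^+ 3
    = pi * (2 * pi ^+ 2 / (d + 2)%:R ^+ 3) :> R.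
  by rewrite exprS mulrCA !mulrA.
by rewrite ler_wpM2l ?pi_ge0 ?cos_pi_div_moment_le// ler_nat addn2.
Qed.

Definition jackson_rate d D : R := pi ^+ 6 / (2 * (d + 2)%:R ^+ 3 * D ^+ 4).

Lemma jackson_tail_le d D :
  0 < D -> pi - jackson_primitive d D <= pi * jackson_rate d D.
Proof.
move=> D_gt0; have pi_pos := @pi_gt0 R.
have N_gt0 : 0 < (d + 2)%:R :> R by rewrite ltr0n addn2.
have [D_le_pi|pi_lt_D] := leP D pi; last first.
  have := jackson_primitive_le d (ltW pi_lt_D).
  rewrite jackson_primitive_pi => G_ge.
  rewrite (@le_trans _ _ 0)//; first by lra.
  by rewrite mulr_ge0 ?divr_ge0 ?mulr_ge0 ?exprn_ge0 ?pi_ge0// ltW.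
have tail_ge0 : 0 <= pi - jackson_primitive d D.
  by rewrite subr_ge0 -[leRHS](jackson_primitive_pi d) jackson_primitive_le.
have weight_ge : (2 * D ^+ 2 / pi ^+ 2) ^+ 2 <= (1 - cos D) ^+ 2.
  rewrite lerXn2r ?nnegrE ?subr_ge0 ?cos_le1 ?one_sub_cos_ge ?(ltW D_gt0)//.
  by rewrite divr_ge0 ?sqr_ge0// mulr_ge0 ?sqr_ge0.
have D_itv : 0 <= D <= pi by rewrite ltW.
have := le_trans (ler_wpM2r tail_ge0 weight_ge) (jackson_tail_markov d D_itv).
have scale_gt0 : 0 < 4 * D ^+ 4 / pi ^+ 4 :> R.
  by rewrite divr_gt0 ?mulr_gt0 ?exprn_gt0.
rewrite /jackson_rate => weighted_le; rewrite -(ler_pM2l scale_gt0).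
move: (pi - jackson_primitive d D) weighted_le => T.
move: (pi : R) (d + 2)%:R (lt0r_neq0 pi_pos) (lt0r_neq0 N_gt0).
move: (lt0r_neq0 D_gt0) => D_neq0 p N p_neq0 N_neq0.
by congr (_ <= _); field; rewrite ?p_neq0 ?N_neq0 ?D_neq0.
Qed.

Definition jackson_arc d : R -> R -> R -> R := smoothed_arc (rho_coef R d) d.

Lemma jackson_arc_inside d a b t D : 0 <= b -> b <= a -> a <= pi -> 0 < D ->
  D <= a - t -> D <= t - b ->
  `|1 - jackson_arc d a b t| <= jackson_rate d D.
Proof.
move=> b_ge0 b_le_a a_le_pi D_gt0 Da Db; have pi_pos := @pi_gt0 R.
have := smoothed_arc_le1 (@jackson_kernel_ge0 d) (rho_coef0 d) t b_ge0 a_le_pi.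
have := smoothed_arc_ge_inside (@jackson_kernel_ge0 d) b_le_a Da Db.
have := jackson_tail_le d D_gt0; rewrite -/(jackson_primitive d).
rewrite -/(jackson_arc d) => tail arc_ge arc_le1.
by rewrite ger0_norm ?subr_ge0// -(ler_pM2l pi_pos); lra.
Qed.

Lemma jackson_arc_outside d a b t D : 0 <= b -> b <= a -> a <= pi ->
  0 <= t <= pi -> 0 < D -> D <= t - a \/ D <= b - t ->
  `|jackson_arc d a b t| <= jackson_rate d D.
Proof.
move=> b_ge0 b_le_a a_le_pi t_itv D_gt0 D_le; have pi_pos := @pi_gt0 R.
rewrite ger0_norm; last exact: (smoothed_arc_ge0 (@jackson_kernel_ge0 d)).
rewrite -(ler_pM2l pi_pos) (le_trans _ (jackson_tail_le d D_gt0))//.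
exact: (smoothed_arc_le_outside (@jackson_kernel_ge0 d) (rho_coef0 d)).
Qed.

End JacksonKernel.

Lemma foldr_selective_mem (T : eqType) (op : T -> T -> T) (x : T) (s : seq T) :
  (forall y z, op y z \in [:: y; z]) -> foldr op x s \in x :: s.
Proof.
move=> opP; elim: s => [|y s IHs] /=; first exact: mem_head.
have := opP y (foldr op x s).
rewrite !inE => /orP[] /eqP->; rewrite ?eqxx ?orbT//.
by move: IHs; rewrite inE => /orP[->//|->]; rewrite !orbT.
Qed.

Section ClosestCosines.
Variable R : realType.
Implicit Types (x y z u : R) (s : seq R).

Lemma seqminP s x :
  x \in s -> exists m, [/\ seqmin s = Some m, m \in s & m <= x].
Proof.
case: s => // y s xs; exists (foldr Num.min y s); split=> //.
  apply: foldr_selective_mem => u z.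
  by rewrite minEle !inE; case: ifP; rewrite eqxx ?orbT.
rewrite foldrE; move: xs; rewrite inE => /predU1P[->|/ge_bigmin_seq].
  exact: bigmin_le_id.
exact.
Qed.

Lemma seqmaxP s x :
  x \in s -> exists m, [/\ seqmax s = Some m, m \in s & x <= m].
Proof.
case: s => // y s xs; exists (foldr Num.max y s); split=> //.
  apply: foldr_selective_mem => u z.
  by rewrite maxEle !inE; case: ifP; rewrite eqxx ?orbT.
rewrite foldrE; move: xs; rewrite inE => /predU1P[->|/le_bigmax_seq].
  exact: bigmax_ge_id.
exact.
Qed.

Lemma seqmin_filterP (I : finType) (P : pred I) (f : I -> R) i : P i ->
  exists j, [/\ seqmin [seq f j | j <- enum I & P j] = Some (f j),
    P j & f j <= f i].
Proof.
move=> Pi; have : f i \in [seq f j | j <- enum I & P j].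
  by rewrite map_f// mem_filter Pi mem_enum.
move=> /seqminP[m [-> /mapP[j + ->]]].
by rewrite mem_filter => /andP[Pj _] ji; exists j.
Qed.

Lemma seqmax_filterP (I : finType) (P : pred I) (f : I -> R) i : P i ->
  exists j, [/\ seqmax [seq f j | j <- enum I & P j] = Some (f j),
    P j & f i <= f j].
Proof.
move=> Pi; have : f i \in [seq f j | j <- enum I & P j].
  by rewrite map_f// mem_filter Pi mem_enum.
move=> /seqmaxP[m [-> /mapP[j + ->]]].
by rewrite mem_filter => /andP[Pj _] ji; exists j.
Qed.

Definition cosine_angle z : R := acos (lmap z).

Lemma lmap_itv z : 0 <= z <= 1 -> lmap z \in `[-1, 1].
Proof.
by move=> /andP[z_ge0 z_le1]; rewrite in_itv/= /lmap; apply/andP; split; nra.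
Qed.

Lemma cos_cosine_angle z : 0 <= z <= 1 -> cos (cosine_angle z) = lmap z.
Proof. by move=> /lmap_itv /acosK. Qed.

Lemma cosine_angle_itv z : 0 <= z <= 1 -> 0 <= cosine_angle z <= pi.
Proof.
by move=> /lmap_itv; rewrite in_itv => zI; rewrite acos_ge0 ?acos_lepi.
Qed.

Lemma cosine_angle_le y z : 0 <= y -> y <= z -> z <= 1 ->
  cosine_angle z <= cosine_angle y.
Proof.
move=> y_ge0 yz z_le1.
rewrite le_acos ?lmap_itv ?y_ge0 ?(le_trans yz) ?(le_trans y_ge0)//.
by rewrite lerB// ler_pM2l// lerXn2r ?nnegrE//; lra.
Qed.

Variables (n : nat) (cmin cmax : R) (c : 'I_n -> R).

Lemma Delta_min_le x :
  let dist (o : option R) (u : R) := omap (fun z => `|acos (lmap z) - u|) o in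
  Some x \in [:: dist (c_il cmin cmax c) (alpha_of cmin);
                 dist (c_ir cmin cmax c) (beta_of cmax);
                 dist (c_ol cmin c) (alpha_of cmin);
                 dist (c_or cmax c) (beta_of cmax)] ->
  Delta_min cmin cmax c <= x.
Proof.
move=> dist; rewrite /Delta_min -/dist; set s := [:: _; _; _; _] => xs.
have : x \in pmap id s by rewrite mem_pmap map_id.
by move=> /seqminP[m [-> _ mx]].
Qed.

Hypothesis c_itv : forall i, 0 <= c i <= 1.

Let c_ge0 i : 0 <= c i. Proof. by have /andP[] := c_itv i. Qed.
Let c_le1 i : c i <= 1. Proof. by have /andP[] := c_itv i. Qed.

Lemma Delta_min_le_below i : cmin <= 1 -> c i < cmin ->
  Delta_min cmin cmax c <= cosine_angle (c i) - alpha_of cmin.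
Proof.
move=> cmin_le1 ci_lt.
have [j [olE cj_lt ij]] := seqmax_filterP (P := fun i => c i < cmin) c ci_lt.
have : Delta_min cmin cmax c <= `|cosine_angle (c j) - alpha_of cmin|.
  by apply: Delta_min_le; rewrite /c_ol olE !inE eqxx !orbT.
have : alpha_of cmin <= cosine_angle (c j).
  exact: cosine_angle_le (ltW cj_lt) _.
have : cosine_angle (c j) <= cosine_angle (c i) by exact: cosine_angle_le.
by move=> ji aj; rewrite ger0_norm; lra.
Qed.

Lemma Delta_min_le_above i : 0 <= cmax -> cmax < c i ->
  Delta_min cmin cmax c <= beta_of cmax - cosine_angle (c i).
Proof.
move=> cmax_ge0 ci_gt.
have [j [orE cj_gt ji]] := seqmin_filterP (P := fun i => cmax < c i) c ci_gt.
have : Delta_min cmin cmax c <= `|cosine_angle (c j) - beta_of cmax|.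
  by apply: Delta_min_le; rewrite /c_or orE !inE eqxx !orbT.
have : cosine_angle (c j) <= beta_of cmax.
  exact: cosine_angle_le (ltW cj_gt) _.
have : cosine_angle (c i) <= cosine_angle (c j) by exact: cosine_angle_le.
by move=> ij jb; rewrite ler0_norm; lra.
Qed.

Lemma Delta_min_le_inside_left i : 0 <= cmin -> cmin <= c i <= cmax ->
  Delta_min cmin cmax c <= alpha_of cmin - cosine_angle (c i).
Proof.
move=> cmin_ge0 ci_in.
have [j [ilE /andP[cj_ge _] ji]] :=
  seqmin_filterP (P := fun i => cmin <= c i <= cmax) c ci_in.
have : Delta_min cmin cmax c <= `|cosine_angle (c j) - alpha_of cmin|.
  by apply: Delta_min_le; rewrite /c_il ilE !inE eqxx.
have : cosine_angle (c j) <= alpha_of cmin by exact: cosine_angle_le.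
have : cosine_angle (c i) <= cosine_angle (c j) by exact: cosine_angle_le.
by move=> ij ja; rewrite ler0_norm; lra.
Qed.

Lemma Delta_min_le_inside_right i : cmax <= 1 -> cmin <= c i <= cmax ->
  Delta_min cmin cmax c <= cosine_angle (c i) - beta_of cmax.
Proof.
move=> cmax_le1 ci_in.
have [j [irE /andP[_ cj_le] ij]] :=
  seqmax_filterP (P := fun i => cmin <= c i <= cmax) c ci_in.
have : Delta_min cmin cmax c <= `|cosine_angle (c j) - beta_of cmax|.
  by apply: Delta_min_le; rewrite /c_ir irE !inE eqxx orbT.
have : beta_of cmax <= cosine_angle (c j) by exact: cosine_angle_le.
have : cosine_angle (c j) <= cosine_angle (c i) by exact: cosine_angle_le.
by move=> ji bj; rewrite ger0_norm; lra.
Qed.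

Lemma jackson_approx_PS_weight d i :
  0 <= cmin -> cmin <= cmax -> cmax <= 1 -> 0 < Delta_min cmin cmax c ->
  `|PS_weight cmin cmax (c i)
    - jackson_arc d (alpha_of cmin) (beta_of cmax) (cosine_angle (c i))|
    <= jackson_rate d (Delta_min cmin cmax c).
Proof.
move=> cmin_ge0 cmin_le cmax_le1 D_gt0.
have cmin_le1 := le_trans cmin_le cmax_le1.
have cmax_ge0 := le_trans cmin_ge0 cmin_le.
have cmin_itv : 0 <= cmin <= 1 by rewrite cmin_ge0.
have cmax_itv : 0 <= cmax <= 1 by rewrite cmax_ge0.
have /andP[beta_ge0 _] : 0 <= beta_of cmax <= pi := cosine_angle_itv cmax_itv.
have /andP[_ alpha_le] : 0 <= alpha_of cmin <= pi := cosine_angle_itv cmin_itv.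
have beta_le : beta_of cmax <= alpha_of cmin by exact: cosine_angle_le.
have angle_itv := cosine_angle_itv (c_itv i).
rewrite /PS_weight; have [ci_below|ci_gt|ciE] := ltgtP (c i) cmin.
- rewrite (lt_eqF (lt_le_trans ci_below cmin_le))/= sub0r normrN.
  by apply: jackson_arc_outside => //; left; exact: Delta_min_le_below.
- have [ci_lt|ci_above|ciE] := ltgtP (c i) cmax; rewrite /=.
  + have ci_in : cmin <= c i <= cmax by rewrite !ltW.
    apply: jackson_arc_inside => //.
      exact: Delta_min_le_inside_left.
    exact: Delta_min_le_inside_right.
  + rewrite sub0r normrN.
    by apply: jackson_arc_outside => //; right; exact: Delta_min_le_above.
  + have := @Delta_min_le_inside_right i cmax_le1.
    by rewrite ciE lexx cmin_le subrr leNgt D_gt0 => /(_ isT).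
- have := @Delta_min_le_inside_left i cmin_ge0.
  by rewrite ciE lexx cmin_le subrr leNgt D_gt0 => /(_ isT).
Qed.

End ClosestCosines.

Section EigenBasis.
Variable K : comUnitRingType.

Lemma mxtrace_eigenbasis n (P X : 'M[K]_n) (v : 'rV_n) : X \in unitmx ->
  P *m X = X *m diag_mx v -> \tr P = \sum_i v 0 i.
Proof.
by move=> Xu PX; rewrite -(mulmxK Xu P) PX mxtrace_mulC mulKmx// mxtrace_diag.
Qed.

Lemma gram_congruence m n (A Sig : 'M[K]_(m, n)) (U : 'M[K]_m) (X : 'M[K]_n) :
  U^T *m U = 1%:M -> U^T *m A *m X = Sig ->
  X^T *m (A^T *m A) *m X = Sig^T *m Sig.
Proof.
move=> /mulmx1C UU <-; rewrite !trmx_mul trmxK !mulmxA.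
by rewrite -(mulmxA (X^T *m A^T) U) UU mulmx1.
Qed.

Lemma generalized_eigenbasis n (H M X : 'M[K]_n) (v : 'rV_n) :
  X^T *m H *m X = 1%:M -> X^T *m M *m X = diag_mx v ->
  invmx H *m M *m X = X *m diag_mx v.
Proof.
rewrite -mulmxA => /mulmx1C HXX <-; rewrite -mulmxA in HXX.
have [Hu _] := mulmx1_unit HXX.
have -> : invmx H = X *m X^T by rewrite -[RHS](mulKmx Hu) HXX mulmx1.
by rewrite !mulmxA.
Qed.

End EigenBasis.

Section MatrixFunctions.
Variable R : realType.

Lemma cheb_mx_eigen n p (S : 'M[R]_n) (X : 'M[R]_(n, p)) (th : 'I_p -> R) j :
  S *m X = X *m diag_mx (\row_i cos (th i)) ->
  cheb_mx S j *m X = X *m diag_mx (\row_i cos (j%:R * th i)).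
Proof.
move=> SX; pose Cos k := diag_mx (\row_i cos (k%:R * th i)).
suff [] : (cheb_pair S j).1 *m X = X *m Cos j
  /\ (cheb_pair S j).2 *m X = X *m Cos j.+1 by [].
rewrite /Cos; elim: j => [|j [IHj IHj1]] /=.
  split; last first.
    by rewrite SX; congr (_ *m diag_mx _); apply/rowP => i; rewrite !mxE mul1r.
  rewrite mul1mx -[LHS]mulmx1 -diag_const_mx; congr (_ *m diag_mx _).
  by apply/rowP => i; rewrite !mxE mul0r cos0.
split=> //; rewrite mulmxBl -scalemxAl -mulmxA IHj1 IHj mulmxA SX -!mulmxA.
rewrite mulmx_diag scalemxAr -mulmxBr -linearZ/= -linearB/=.
congr (_ *m diag_mx _); apply/rowP => i; rewrite !mxE.
have -> : j.+2%:R * th i = j.+1%:R * th i + th i by ring.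
have -> : j%:R * th i = j.+1%:R * th i - th i by ring.
by rewrite cosB cosD; ring.
Qed.

Lemma psi_mx_eigen n p (S : 'M[R]_n) (X : 'M[R]_(n, p)) (th : 'I_p -> R)
    cmin cmax d :
  S *m X = X *m diag_mx (\row_i cos (th i)) ->
  psi_mx cmin cmax d S *m X =
    X *m diag_mx (\row_i jackson_arc d (alpha_of cmin) (beta_of cmax) (th i)).
Proof.
move=> SX; rewrite mulmx_suml.
under eq_bigr => j _.
  rewrite -scalemxAl (cheb_mx_eigen _ SX) scalemxAr -linearZ/=.
  over.
rewrite -mulmx_sumr -linear_sum; congr (_ *m diag_mx _).
by apply/rowP => i; rewrite summxE mxE; apply: eq_bigr => j _; rewrite !mxE.
Qed.

Lemma mxtrace_PS_mx n cmin cmax (c : 'I_n -> R) (X H : 'M[R]_n) :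
  X^T *m H *m X = 1%:M ->
  \tr (PS_mx cmin cmax c X H) = \sum_i PS_weight cmin cmax (c i).
Proof.
move=> XHX; rewrite /PS_mx raddf_sum/=; apply: eq_bigr => i _.
rewrite mxtraceZ -mulmxA mxtrace_mulC -[RHS]mulr1; congr (_ * _).
have -> : (col i X)^T *m H *m col i X = row i (col i (X^T *m H *m X)).
  by rewrite tr_col !colE !row_mul !mulmxA.
by rewrite XHX trace_mx11 !mxE eqxx.
Qed.

End MatrixFunctions.

Theorem theorem3p4 (R : realType) (m1 m2 n : nat)
    (A : 'M[R]_(m1, n)) (B : 'M[R]_(m2, n))
    (U : 'M[R]_m1) (V : 'M[R]_m2) (X : 'M[R]_n)
    (SigA : 'M[R]_(m1, n)) (SigB : 'M[R]_(m2, n))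
    (c s : 'I_n -> R) (cmin cmax : R) (d : nat) :
  (n <= m1 + m2)%N ->
  \rank (col_mx A B) = n ->
  (* GSVD *)
  U^T *m U = 1%:M -> V^T *m V = 1%:M -> X \in unitmx ->
  U^T *m A *m X = SigA -> V^T *m B *m X = SigB ->
  SigA^T *m SigA = diag_mx (\row_i (c i) ^+ 2) ->
  SigB^T *m SigB = diag_mx (\row_i (s i) ^+ 2) ->
  (forall i, 0 <= c i) -> (forall i, 0 <= s i) ->
  (forall i, c i ^+ 2 + s i ^+ 2 = 1) ->
  (* the interval [cmin, cmax] in [0,1] *)
  0 <= cmin -> cmin <= cmax -> cmax <= 1 ->
  let H := A^T *m A + B^T *m B in
  let S := invmx H *m (A^T *m A - B^T *m B) in
  let PS := PS_mx cmin cmax c X H in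
  let P := psi_mx cmin cmax d S in
  let Dm := Delta_min cmin cmax c in
  0 < Dm ->
  `|\tr PS - \tr P| <= n%:R * pi ^+ 6 / (2 * (d + 2)%:R ^+ 3 * Dm ^+ 4).
Proof.
move=> _ _ UU VV Xu UAX VBX SA SB c_ge0 _ cs cmin_ge0 cmin_le cmax_le1.
move=> H S PS P Dm Dm_gt0.
have c_itv i : 0 <= c i <= 1.
  by rewrite c_ge0 -(@expr_le1 _ 2)// -(cs i) lerDl sqr_ge0.
have gramA := gram_congruence UU UAX; have gramB := gram_congruence VV VBX.
have XHX : X^T *m H *m X = 1%:M.
  rewrite mulmxDr mulmxDl gramA gramB SA SB -linearD/= -diag_const_mx.
  by congr diag_mx; apply/rowP => i; rewrite !mxE cs.
have SX : S *m X = X *m diag_mx (\row_i cos (cosine_angle (c i))).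
  apply: generalized_eigenbasis XHX _.
  rewrite mulmxBr mulmxBl gramA gramB SA SB -linearB/=; congr diag_mx.
  by apply/rowP => i; rewrite !mxE cos_cosine_angle// /lmap; have := cs i; lra.
rewrite (mxtrace_PS_mx _ _ _ XHX).
rewrite (mxtrace_eigenbasis Xu (psi_mx_eigen _ _ _ SX)).
under [X in _ - X]eq_bigr do rewrite mxE; rewrite -sumrB.
rewrite (le_trans (ler_norm_sum _ _ _))// -mulrA mulr_natl.
rewrite -[n in leRHS]card_ord -sumr_const.
by apply: ler_sum => i _; exact: jackson_approx_PS_weight.
Qed.
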